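(* Let $M$ be a lightlike hypersurface of an indefinite statistical manifold $(\overline{M},\overline{g},\overline{\nabla},\overline{\nabla}^{*})$, with screen distribution $S(TM)$ and induced connections $\nabla$ and $\nabla^{*}$. The following assertions are equivalent: (1) $S(TM)$ is parallel with respect to both $\nabla$ and $\nabla^{*}$; (2) $C=C^{*}=0$ on $TM\times S(TM)$; (3) $A_NX,\,A_N^{*}X\in\Gamma(\mathrm{Rad}(TM))$ for all $X\in\Gamma(TM)$; (4) $S(TM)$ is parallel with respect to $\nabla^{0}$ and $K(X,W)\in\Gamma(S(TM))$ for all $X\in\Gamma(TM)$ and $W\in\Gamma(S(TM))$.
   Context: $\Gamma(E)$ denotes smooth sections of $E$. An indefinite statistical manifold $(\overline{M},\overline{g},\overline{\nabla},\overline{\nabla}^{*})$ is a semi-Riemannian manifold $(\overline M,\overline g)$ with a torsion-free affine connection $\overline\nabla$ satisfying the Codazzi condition $(\overline{\nabla}_{X}\overline{g})(Y,Z)=(\overline{\nabla}_{Y}\overline{g})(X,Z)$, together with the dual connection $\overline\nabla^{*}$ determined by $X\overline{g}(Y,Z)=\overline{g}(\overline{\nabla}_{X}Y,Z)+\overline{g}(Y,\overline{\nabla}^{*}_{X}Z)$ (which is then also torsion-free). $M$ is a lightlike hypersurface: $M$ has codimension one and the induced metric $g$ is degenerate, so $\mathrm{Rad}(TM)=TM\cap TM^{\perp}=TM^{\perp}$ is a rank-one bundle. A screen distribution $S(TM)$ is a non-degenerate distribution complementary to $\mathrm{Rad}(TM)$ in $TM$; one is fixed. Fix a nowhere-zero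 section $\xi$ of $\mathrm{Rad}(TM)$ (in general it exists only locally, and all objects depending on it are understood on its domain). $N$ is the unique vector field along $M$ with $\overline{g}(N,N)=0$, $\overline{g}(N,\xi)=1$, $\overline{g}(N,W)=0$ for all $W\in\Gamma(S(TM))$; then $T\overline M|_M=TM\oplus\mathrm{span}\{N\}$. For $X,Y\in\Gamma(TM)$ the Gauss formulas $\overline{\nabla}_{X}Y=\nabla_{X}Y+B(X,Y)N$ and $\overline{\nabla}^{*}_{X}Y=\nabla^{*}_{X}Y+B^{*}(X,Y)N$, with $\nabla_XY,\nabla^*_XY\in\Gamma(TM)$, define the induced torsion-free connections $\nabla,\nabla^{*}$. The Weingarten formulas $\overline{\nabla}_{X}N=-A^{*}_{N}X+\tau^{*}(X)N$ and $\overline{\nabla}^{*}_{X}N=-A_{N}X+\tau(X)N$, with $A_NX,A_N^{*}X\in\Gamma(TM)$, define the operators $A_N,A_N^{*}$ and one-forms $\tau,\tau^{*}$ (note the placement of the stars). For $X\in\Gamma(TM)$, $W\in\Gamma(S(TM))$ the decompositions $\nabla_{X}W=\nabla^{S}_{X}W+C(X,W)\xi$ and $\nabla^{*}_{X}W=\nabla^{*S}_{X}W+C^{*}(X,W)\xi$, with $\nabla^{S}_{X}W,\nabla^{*S}_XW\in\Gamma(S(TM))$, define the local screen fundamental forms $C,C^{*}$. Put $\nabla^{0}=\frac12(\nabla+\nabla^{*})$ and $K(X,Y)=\frac12(\nabla_XY-\nabla^{*}_XY)$. A distribution $\mathcal D$ on $M$ is parallel with respect to a connection $D$ if $D_XY\in\Gamma(\mathcal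 D)$ for all $X\in\Gamma(TM)$, $Y\in\Gamma(\mathcal D)$. *)

(* Defs.v *)
From HB Require Import structures.
From mathcomp Require Import all_boot all_order all_algebra.
From mathcomp Require Import all_classical all_reals all_analysis.
Set Implicit Arguments.
Unset Strict Implicit.
Unset Printing Implicit Defensive.
Import Order.TTheory GRing.Theory Num.Theory numFieldNormedType.Exports.
Local Open Scope classical_set_scope.
Local Open Scope ring_scope.

Fixpoint Ck (R : realType) (m k : nat) (A : set 'rV[R]_m) (f : 'rV[R]_m -> R)
    : Prop :=
  match k with
  | 0%N => forall x, A x -> {for x, continuous f}
  | k'.+1 => (forall x, A x -> differentiable f x) /\
             (forall v : 'rV[R]_m, Ck k' A (fun x => 'D_v f x))
  end.

Definition Coo (R : realType) (m : nat) (A : set 'rV[R]_m)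
    (f : 'rV[R]_m -> R) : Prop :=
  forall k, Ck k A f.

(* [coo] and [coo_inv] are total; only their values on [dom] and on
   [coo @` dom] are meaningful. *)
Record chart (R : realType) (m : nat) (M : topologicalType) := Chart {
  dom : set M;
  coo : M -> 'rV[R]_m;
  coo_inv : 'rV[R]_m -> M }.

Definition is_chart (R : realType) (m : nat) (M : topologicalType)
    (c : chart R m M) : Prop :=
  [/\ open (dom c), open (coo c @` dom c),
      forall p, dom c p -> coo_inv c (coo c p) = p,
      forall p, dom c p -> {for p, continuous (coo c)} &
      forall x, (coo c @` dom c) x -> {for x, continuous (coo_inv c)}].

Definition smooth_in_charts (R : realType) (m k : nat)
    (M N : topologicalType) (c : chart R m M) (d : chart R k N)
    (F : M -> N) : Prop :=
  forall a : 'I_k, Coo (coo c @` (dom c `&` F @^-1` dom d))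
    (fun x => coo d (F (coo_inv c x)) ord0 a).

Record manifold (R : realType) (m : nat) := Manifold {
  points :> topologicalType;
  atlas : set (chart R m points);
  manifold_hausdorff : hausdorff_space points;
  manifold_second_countable : @second_countable points;
  atlas_chart : forall c, atlas c -> is_chart c;
  atlas_cover : forall p, exists2 c, atlas c & dom c p;
  atlas_compatible : forall c d, atlas c -> atlas d ->
    smooth_in_charts c d id }.

Definition smooth_on (R : realType) (m : nat) (M : manifold R m)
    (V : set M) (f : M -> R) : Prop :=
  forall c, atlas c -> Coo (coo c @` (V `&` dom c)) (f \o coo_inv c).

Definition smooth_at (R : realType) (m : nat) (M : manifold R m) (p : M)
    (f : M -> R) : Prop :=
  exists V : set M, [/\ open V, V p & smooth_on V f].

Definition smooth_map (R : realType) (m k : nat) (M : manifold R m)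
    (N : manifold R k) (F : M -> N) : Prop :=
  continuous F /\
  forall c d, atlas c -> atlas d -> smooth_in_charts c d F.

(* A tangent vector at [p] is encoded as the directional derivative it
   induces on functions that are smooth near [p].  It is set to 0 on all other
   functions, so that equality of tangent vectors is Leibniz equality. *)
Definition tvec (R : realType) (m : nat) (M : manifold R m) : lmodType R :=
  ((M -> R) -> R^o).

Definition chart_vec (R : realType) (m : nat) (M : manifold R m)
    (c : chart R m M) (p : M) (v : 'rV[R]_m) : tvec M :=
  fun f => if `[< smooth_at p f >] then 'D_v (f \o coo_inv c) (coo c p) else 0.

Definition tangent (R : realType) (m : nat) (M : manifold R m) (p : M)
    : set (tvec M) :=
  [set w | exists c v, [/\ atlas c, dom c p & w = chart_vec c p v]].

Definition pushforward (R : realType) (m k : nat) (M : manifold R m)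
    (N : manifold R k) (i : M -> N) (p : M) (v : tvec M) : tvec N :=
  fun f => if `[< smooth_at (i p) f >] then v (f \o i) else 0.

(* Smooth sections over the open set [V] of the pull-back bundle i^*TN. *)
Definition field_along (R : realType) (m k : nat) (M : manifold R m)
    (N : manifold R k) (i : M -> N) (V : set M) (Y : M -> tvec N) : Prop :=
  (forall p, V p -> tangent (i p) (Y p)) /\
  (forall (W : set N) (f : N -> R), open W -> smooth_on W f ->
     smooth_on (V `&` i @^-1` W) (fun p => Y p f)).

Definition vfield (R : realType) (m : nat) (M : manifold R m) (V : set M)
    (X : M -> tvec M) : Prop :=
  @field_along R m m M M id V X.

(* Smooth sections over [V] of a subbundle [E] of TM. *)
Definition section (R : realType) (m : nat) (M : manifold R m) (V : set M)
    (E : M -> set (tvec M)) (X : M -> tvec M) : Prop :=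
  vfield V X /\ forall p, V p -> E p (X p).

Definition bracket (R : realType) (m : nat) (M : manifold R m)
    (X Y : M -> tvec M) : M -> tvec M :=
  fun p f => if `[< smooth_at p f >]
             then X p (fun q => Y q f) - Y p (fun q => X q f) else 0.

Definition distribution (R : realType) (m : nat) (M : manifold R m) (r : nat)
    (E : M -> set (tvec M)) : Prop :=
  forall p : M, exists (V : set M) (e : 'I_r -> M -> tvec M),
    [/\ open V, V p, forall j, vfield V (e j) &
        forall q, V q ->
          E q = [set v | exists a : 'I_r -> R, v = \sum_j a j *: e j q] /\
          (forall a : 'I_r -> R,
             \sum_j a j *: e j q = 0 -> forall j, a j = 0)].

(* Covariant differentiation, along vector fields of M, of sections of i^*TN.
   The operator acts on total functions; it is constrained only on
   fields that are smooth on some open set [V], on which it must be local, so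
   that it gives a connection over every open subset. *)
Definition connection_along (R : realType) (m k : nat) (M : manifold R m)
    (N : manifold R k) (i : M -> N)
    (D : (M -> tvec M) -> (M -> tvec N) -> (M -> tvec N)) : Prop :=
  forall V : set M, open V ->
  [/\ forall X Y, vfield V X -> field_along i V Y -> field_along i V (D X Y),
      forall X X' Y Y', vfield V X -> vfield V X' ->
        field_along i V Y -> field_along i V Y' ->
        (forall p, V p -> X p = X' p) -> (forall p, V p -> Y p = Y' p) ->
        forall p, V p -> D X Y p = D X' Y' p,
      forall X X' Y f, vfield V X -> vfield V X' -> field_along i V Y ->
        smooth_on V f ->
        forall p, V p ->
          D (fun q => f q *: X q + X' q) Y p = f p *: D X Y p + D X' Y p,
      forall X Y Y', vfield V X -> field_along i V Y -> field_along i V Y' ->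
        forall p, V p -> D X (fun q => Y q + Y' q) p = D X Y p + D X Y' p &
      forall X Y f, vfield V X -> field_along i V Y -> smooth_on V f ->
        forall p, V p ->
          D X (fun q => f q *: Y q) p = X p f *: Y p + f p *: D X Y p].

Definition affine_connection (R : realType) (m : nat) (M : manifold R m)
    (D : (M -> tvec M) -> (M -> tvec M) -> (M -> tvec M)) : Prop :=
  @connection_along R m m M M id D.

(* [D] is the (unique) connection on i^*TN induced by the affine connection
   [nab] of N: it gives meaning to [nab X Y] when X is tangent to M and Y is
   only defined along i. *)
Definition pullback_connection (R : realType) (m k : nat) (M : manifold R m)
    (N : manifold R k) (i : M -> N)
    (nab : (N -> tvec N) -> (N -> tvec N) -> (N -> tvec N))
    (D : (M -> tvec M) -> (M -> tvec N) -> (M -> tvec N)) : Prop :=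
  connection_along i D /\
  forall (V : set M) (W : set N) (X : M -> tvec M) (Z Y : N -> tvec N) (p : M),
    open V -> open W -> vfield V X -> vfield W Z -> vfield W Y ->
    V p -> W (i p) -> Z (i p) = pushforward i p (X p) ->
    D X (Y \o i) p = nab Z Y (i p).

(* There is a k-dimensional subspace of T_pM on which [g p] is negative
   definite. *)
Definition negative_family (R : realType) (m : nat) (M : manifold R m)
    (g : M -> tvec M -> tvec M -> R) (p : M) (k : nat) : Prop :=
  exists e : 'I_k -> tvec M,
    (forall j, tangent p (e j)) /\
    forall a : 'I_k -> R, (exists j, a j != 0) ->
      g p (\sum_j a j *: e j) (\sum_j a j *: e j) < 0.

Definition semi_riemannian (R : realType) (m : nat) (M : manifold R m)
    (g : M -> tvec M -> tvec M -> R) : Prop :=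
  [/\ forall p u v w a, tangent p u -> tangent p v -> tangent p w ->
        g p (a *: u + v) w = a * g p u w + g p v w,
      forall p u v, tangent p u -> tangent p v -> g p u v = g p v u,
      forall p u, tangent p u -> (forall v, tangent p v -> g p u v = 0) ->
        u = 0,
      forall V X Y, open V -> vfield V X -> vfield V Y ->
        smooth_on V (fun p => g p (X p) (Y p)) &
      exists nu : nat, forall p,
        negative_family g p nu /\ ~ negative_family g p nu.+1].

Definition torsion_free (R : realType) (m : nat) (M : manifold R m)
    (D : (M -> tvec M) -> (M -> tvec M) -> (M -> tvec M)) : Prop :=
  forall V X Y, open V -> vfield V X -> vfield V Y ->
    forall p, V p -> D X Y p - D Y X p = bracket X Y p.

(* (D_X g)(Y, Z) *)
Definition cov_metric (R : realType) (m : nat) (M : manifold R m)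
    (g : M -> tvec M -> tvec M -> R)
    (D : (M -> tvec M) -> (M -> tvec M) -> (M -> tvec M))
    (X Y Z : M -> tvec M) (p : M) : R :=
  X p (fun q => g q (Y q) (Z q)) - g p (D X Y p) (Z p) - g p (Y p) (D X Z p).

Definition statistical_manifold (R : realType) (m : nat) (M : manifold R m)
    (g : M -> tvec M -> tvec M -> R)
    (nab nabs : (M -> tvec M) -> (M -> tvec M) -> (M -> tvec M)) : Prop :=
  [/\ semi_riemannian g,
      affine_connection nab /\ torsion_free nab,
      forall V X Y Z, open V -> vfield V X -> vfield V Y -> vfield V Z ->
        forall p, V p -> cov_metric g nab X Y Z p = cov_metric g nab Y X Z p,
      affine_connection nabs &
      forall V X Y Z, open V -> vfield V X -> vfield V Y -> vfield V Z ->
        forall p, V p ->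
          X p (fun q => g q (Y q) (Z q))
          = g p (nab X Y p) (Z p) + g p (Y p) (nabs X Z p)].

Definition hypersurface (R : realType) (m : nat) (Mb : manifold R m.+1)
    (M : manifold R m) (i : M -> Mb) : Prop :=
  [/\ injective i, smooth_map i &
      forall p v, tangent p v -> pushforward i p v = 0 -> v = 0].

Section Lightlike.
Variables (R : realType) (m : nat) (Mb : manifold R m.+1) (M : manifold R m).
Variables (i : M -> Mb) (g : Mb -> tvec Mb -> tvec Mb -> R).

Local Notation vf := (M -> tvec M).
Local Notation vfb := (M -> tvec Mb).

Definition induced_metric (p : M) (u v : tvec M) : R :=
  g (i p) (pushforward i p u) (pushforward i p v).

(* TM^perp, a subset of TMb restricted to M *)
Definition normal_space (p : M) : set (tvec Mb) :=
  [set v | tangent (i p) v /\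
           forall u, tangent p u -> g (i p) v (pushforward i p u) = 0].

Definition Rad (p : M) : set (tvec M) :=
  [set v | tangent p v /\ normal_space p (pushforward i p v)].

Definition lightlike_hypersurface : Prop :=
  hypersurface i /\ forall p, exists2 v, Rad p v & v != 0.

Definition screen_distribution (S : M -> set (tvec M)) : Prop :=
  [/\ distribution m.-1 S,
      forall p v, S p v -> (forall w, S p w -> induced_metric p v w = 0) ->
        v = 0,
      forall p v, tangent p v -> exists s r, [/\ S p s, Rad p r & v = s + r] &
      forall p v, S p v -> Rad p v -> v = 0].

Definition radical_section (U : set M) (xi : vf) : Prop :=
  section U Rad xi /\ forall p, U p -> xi p != 0.

Definition transversal_section (S : M -> set (tvec M)) (U : set M) (xi : vf)
    (N : vfb) : Prop :=
  field_along i U N /\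
  forall p, U p ->
    [/\ g (i p) (N p) (N p) = 0, g (i p) (N p) (pushforward i p (xi p)) = 1 &
        forall w, S p w -> g (i p) (N p) (pushforward i p w) = 0].

Definition along (X : vf) : vfb := fun p => pushforward i p (X p).

Definition gauss_formula (U : set M) (N : vfb) (Db : vf -> vfb -> vfb)
    (D : vf -> vf -> vf) (B : vf -> vf -> M -> R) : Prop :=
  forall X Y, vfield U X -> vfield U Y ->
    vfield U (D X Y) /\
    forall p, U p -> Db X (along Y) p = along (D X Y) p + B X Y p *: N p.

Definition weingarten_formula (U : set M) (N : vfb) (Db : vf -> vfb -> vfb)
    (A : vf -> vf) (tau : vf -> M -> R) : Prop :=
  forall X, vfield U X ->
    vfield U (A X) /\
    forall p, U p -> Db X N p = - along (A X) p + tau X p *: N p.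

End Lightlike.

Section Screen.
Variables (R : realType) (m : nat) (M : manifold R m).

Local Notation vf := (M -> tvec M).

Definition screen_decomposition (S : M -> set (tvec M)) (U : set M) (xi : vf)
    (D DS : vf -> vf -> vf) (C : vf -> vf -> M -> R) : Prop :=
  forall X W, vfield U X -> section U S W ->
    section U S (DS X W) /\
    forall p, U p -> D X W p = DS X W p + C X W p *: xi p.

Definition parallel (U : set M) (E : M -> set (tvec M)) (D : vf -> vf -> vf)
    : Prop :=
  forall X Y, vfield U X -> section U E Y -> section U E (D X Y).

Definition mean_connection (D D' : vf -> vf -> vf) : vf -> vf -> vf :=
  fun X Y p => 2^-1 *: (D X Y p + D' X Y p).

Definition difference_tensor (D D' : vf -> vf -> vf) : vf -> vf -> vf :=
  fun X Y p => 2^-1 *: (D X Y p - D' X Y p).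

End Screen.

(* Main.v *)
(* Differentiating g(W, N) = 0 along M with the duality of the two connections
   gives C(X, W) = g(A_N X, W), and g(N, W) = 0 gives C*(X, W) = g(A*_N X, W),
   for W in the screen.  As TM is the sum of S(TM) and Rad(TM), and Rad(TM) is
   orthogonal to TM, this identifies (2) with (3); (1) <-> (2) is the
   decomposition nabla_X W = nabla^S_X W + C(X, W) xi, and (1) <-> (4) is linear
   algebra.  Two points take work: duality is only assumed for fields on the
   ambient manifold and is carried to fields along i through the coordinate
   frames of a chart; and (2) only speaks of screen sections over the whole of U,
   so that every vector of the screen has to be extended to such a section with
   a bump function. *)
Require Import Defs.
From HB Require Import structures.
From mathcomp Require Import all_boot all_order all_algebra.
From mathcomp Require Import all_classical all_reals all_analysis.
From mathcomp Require Import ring lra.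
Set Implicit Arguments.
Unset Strict Implicit.
Unset Printing Implicit Defensive.
Import Order.TTheory GRing.Theory Num.Theory numFieldNormedType.Exports.
Local Open Scope classical_set_scope.
Local Open Scope ring_scope.

Local Notation pushforward := Defs.pushforward.

(** * Calculus of the classes [Ck] on row vectors *)

Lemma near_eq_differentiable (R : realType) (V W : normedModType R)
    (f g : V -> W) (x : V) :
  {near x, f =1 g} -> differentiable f x -> differentiable g x.
Proof.
move=> fg df.
have gf : {near x, f =1 g} := fg.
have fxgx := nbhs_singleton gf.
(* [z] vanishes near [x], so the zero map satisfies the expansion that characterises its
   differential; then [g] is [f + z]. *)
pose z := g - f.
suff dz : differentiable z x by rewrite -[g](subrK f); exact: differentiableD.
have zx : z x = 0 by rewrite /z !fctE -fxgx subrr.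
have e : z \o shift x = cst (z x) + (\0 : {linear V -> W}) +o_0 id.
  apply/eqaddoP => eps eps0.
  have : \forall y \near 0, f (y + x) = g (y + x).
    have /nbhs0P gf0 := gf.
    by apply: filterS gf0 => y; rewrite addrC.
  apply: filterS => y fgy; rewrite !fctE /= zx /z !fctE fgy subrr addr0 subr0.
  by rewrite normr0 mulr_ge0 // ltW.
have c0 : continuous (\0 : V -> W) by move=> y; exact: cst_continuous.
have d0 : 'd z x = \0 :> (V -> W) := diff_unique c0 e.
apply/diff_locallyP; split; last by rewrite d0.
by rewrite d0.
Qed.

Section Calculus.
Variables (R : realType) (m : nat).
Implicit Types (A B : set 'rV[R]_m) (f g : 'rV[R]_m -> R).

Lemma near_open A f g x :
  open A -> A x -> (forall y, A y -> f y = g y) -> {near x, f =1 g}.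
Proof.
by move=> oA Ax fg; apply: filterS (open_nbhs_nbhs (conj oA Ax)) => y /fg.
Qed.

(** As [A] is open, the two functions have the same germ at each of its points, hence the same
    derivatives there, whatever their values outside [A]. *)
Lemma Ck_eq k A f g : open A -> (forall x, A x -> f x = g x) ->
  Ck k A f -> Ck k A g.
Proof.
move=> oA; elim: k f g => [|k IH] f g fg /=.
  move=> cf x Ax; have fgx := near_open oA Ax fg.
  have cfx : f @ x --> f x := cf x Ax.
  rewrite /prop_for /continuous_at -(fg x Ax).
  exact: cvg_trans (near_eq_cvg fgx) cfx.
move=> [df Df]; split=> [x Ax|v].
  exact: near_eq_differentiable (near_open oA Ax fg) (df x Ax).
apply: IH (Df v) => x Ax; apply: near_eq_derive; exact: near_open oA Ax fg.
Qed.

(** Every clause of [Ck] is a condition at single points of the set, so it may be checked with a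
    different [B] for each point. *)
Lemma Ck_locality k A f :
  (forall x, A x -> exists2 B, B x & Ck k B f) -> Ck k A f.
Proof.
elim: k f => [|k IH] f H.
  by move=> x /H [B Bx cf]; exact: cf.
split=> [x /H [B Bx [df _]]|v]; first exact: df.
by apply: IH => x /H [B Bx [_ HB]]; exists B => //; exact: HB.
Qed.

Lemma CkS k A f : Ck k.+1 A f -> Ck k A f.
Proof.
elim: k f => [|k IH] f /= [df Df].
  by move=> x /df dfx; exact: differentiable_continuous.
by split=> // v; apply: IH; exact: Df.
Qed.

Lemma Ck_cst k A (a : R) : Ck k A (fun=> a).
Proof.
elim: k a => [|k IH] a /=; first by move=> x _; exact: cst_continuous.
split=> [x _|v]; first exact: differentiable_cst.
rewrite (_ : (fun x => 'D_v _ x) = fun=> 0); first exact: IH.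
by apply/funext => x; exact: derive_cst.
Qed.

Lemma CkD k A f g : open A ->
  Ck k A f -> Ck k A g -> Ck k A (fun x => f x + g x).
Proof.
move=> oA; elim: k f g => [|k IH] f g /=.
  by move=> cf cg x Ax; apply: continuousD; [exact: cf|exact: cg].
move=> [df Df] [dg Dg]; split=> [x Ax|v].
  by apply: differentiableD; [exact: df|exact: dg].
apply: Ck_eq (IH _ _ (Df v) (Dg v)) => // x Ax.
by rewrite -deriveD //; apply: diff_derivable; [exact: df|exact: dg].
Qed.

Lemma CkM k A f g : open A ->
  Ck k A f -> Ck k A g -> Ck k A (fun x => f x * g x).
Proof.
move=> oA; elim: k f g => [|k IH] f g.
  by move=> cf cg x Ax; apply: continuousM; [exact: cf|exact: cg].
move=> Cf Cg; have [df Df] := Cf; have [dg Dg] := Cg; split=> [x Ax|v].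
  by apply: differentiableM; [exact: df|exact: dg].
have := CkD oA (IH _ _ (CkS Cf) (Dg v)) (IH _ _ (CkS Cg) (Df v)).
apply: Ck_eq => // x Ax.
by rewrite -deriveM //; apply: diff_derivable; [exact: df|exact: dg].
Qed.

Lemma Ck_sum k A (I : finType) (F : I -> 'rV[R]_m -> R) : open A ->
  (forall j, Ck k A (F j)) -> Ck k A (fun x => \sum_j F j x).
Proof.
move=> oA CF.
elim: (index_enum I) => [|j s IH].
  by under eq_fun do rewrite big_nil; exact: Ck_cst.
by under eq_fun do rewrite big_cons; exact: CkD.
Qed.

Lemma Ck_coord k A (a : 'I_m) : Ck k A (fun x => x ord0 a).
Proof.
case: k => [|k] /=; first by move=> x _; exact: coord_continuous.
split=> [x _|v]; first exact: differentiable_coord.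
rewrite (_ : (fun x => 'D_v _ x) = fun=> v ord0 a); first exact: Ck_cst.
apply/funext => x.
(* The coordinate is packaged as a linear map, so that it is its own differential. *)
have @f : {linear 'rV[R]_m -> R}.
  by exists (fun N : 'rV[R]_m => N ord0 a); do 2![eexists]; do ?[constructor];
     rewrite ?mxE// => ? *; rewrite ?mxE//; move=> ?; rewrite !mxE.
rewrite (_ : (fun _ => _) = f) // deriveE; last exact: differentiable_coord.
rewrite diff_lin //; exact: coord_continuous.
Qed.
End Calculus.

(** * Chain rule and composition in coordinates *)

Section Composition.
Variables (R : realType) (m k : nat).

Lemma row_fun_sum (F : 'rV[R]_m -> 'rV[R]_k) :
  F = \sum_a (fun x => F x ord0 a *: delta_mx ord0 a).
Proof. by apply/funext => x; rewrite fct_sumE -row_sum_delta. Qed.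

Lemma row_continuous (F : 'rV[R]_m -> 'rV[R]_k) x :
  (forall a, {for x, continuous (fun y => F y ord0 a)}) ->
  {for x, continuous F}.
Proof.
move=> cF; rewrite [F]row_fun_sum.
elim/big_ind : _ => [|G H cG cH|a _].
- exact: cst_continuous.
- exact: continuousD.
- by apply: continuousZr_tmp; exact: cF.
Qed.

Lemma row_differentiable (F : 'rV[R]_m -> 'rV[R]_k) x :
  (forall a, differentiable (fun y => F y ord0 a) x) -> differentiable F x.
Proof.
move=> dF; rewrite [F]row_fun_sum; apply: differentiable_sum => a.
exact: differentiableZl.
Qed.

Lemma derive_row (F : 'rV[R]_m -> 'rV[R]_k) x v :
  (forall a, differentiable (fun y => F y ord0 a) x) ->
  'd F x v = \sum_a 'D_v (fun y => F y ord0 a) x *: delta_mx ord0 a.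
Proof.
move=> dF; rewrite -deriveE; last exact: row_differentiable.
rewrite {1}[F]row_fun_sum derive_sum => [|a].
  apply: eq_bigr => a _; rewrite deriveE; last exact: differentiableZl.
  by rewrite diffZl // -deriveE.
by apply: diff_derivable; exact: differentiableZl.
Qed.

Lemma chain_rule (F : 'rV[R]_m -> 'rV[R]_k) (f : 'rV[R]_k -> R) x v :
  (forall a, differentiable (fun y => F y ord0 a) x) ->
  differentiable f (F x) ->
  'D_v (f \o F) x =
    \sum_a 'D_v (fun y => F y ord0 a) x * 'D_(delta_mx ord0 a) f (F x).
Proof.
move=> dF df; have dFx := row_differentiable dF.
rewrite deriveE; last exact: differentiable_comp.
rewrite diff_comp //= derive_row // linear_sum.
by apply: eq_bigr => a _; rewrite linearZ /= -deriveE.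
Qed.

Lemma Ck_comp n A B (F : 'rV[R]_m -> 'rV[R]_k) (f : 'rV[R]_k -> R) :
  open A -> (forall x, A x -> B (F x)) ->
  (forall a, Ck n A (fun x => F x ord0 a)) -> Ck n B f -> Ck n A (f \o F).
Proof.
move=> oA AB; elim: n f => [|n IH] f CF Cf.
  move=> x Ax; apply: continuous_comp; last exact/Cf/AB.
  by apply: row_continuous => a; exact: CF.
have [df Df] := Cf; have dF x a (Ax : A x) := (CF a).1 x Ax.
split=> [x Ax|v].
  apply: differentiable_comp; last exact/df/AB.
  by apply: row_differentiable => a; exact: dF.
have CF' a : Ck n A (fun x => F x ord0 a) by exact: CkS.
(* By the chain rule the derivative is a sum of products of a derivative of [F] and a partial
   derivative of [f] along [F]; the induction is over all [f] so as to cover these partial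
   derivatives. *)
have := Ck_sum oA (fun a => CkM oA ((CF a).2 v)
  (IH _ CF' (Df (delta_mx ord0 a)))).
apply: Ck_eq => // x Ax; rewrite chain_rule //; last exact/df/AB.
by move=> a; exact: dF.
Qed.

End Composition.

(** * Smooth functions on row vectors *)

Section Smooth.
Variables (R : realType) (m : nat).
Implicit Types (A B : set 'rV[R]_m) (f g : 'rV[R]_m -> R).

Lemma Coo_eq A f g : open A -> (forall x, A x -> f x = g x) ->
  Coo A f -> Coo A g.
Proof. by move=> oA fg Cf n; exact: Ck_eq (Cf n). Qed.

Lemma Coo_locality A f :
  (forall x, A x -> exists2 B, B x & Coo B f) -> Coo A f.
Proof.
by move=> H n; apply: Ck_locality => x /H [B Bx CB]; exists B.
Qed.

Lemma Coo_sub A B f : B `<=` A -> Coo A f -> Coo B f.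
Proof. by move=> BA CA; apply: Coo_locality => x /BA Ax; exists A. Qed.

Lemma Coo_differentiable A f x : Coo A f -> A x -> differentiable f x.
Proof. by move=> /(_ 1%N) [df _]; exact: df. Qed.

Lemma Coo_derive A f v : Coo A f -> Coo A (fun x => 'D_v f x).
Proof. by move=> Cf n; have [_] := Cf n.+1; exact. Qed.

Lemma Coo_cst A (a : R) : Coo A (fun=> a).
Proof. by move=> n; exact: Ck_cst. Qed.

Lemma CooD A f g : open A -> Coo A f -> Coo A g -> Coo A (fun x => f x + g x).
Proof. by move=> oA Cf Cg n; exact: CkD. Qed.

Lemma CooM A f g : open A -> Coo A f -> Coo A g -> Coo A (fun x => f x * g x).
Proof. by move=> oA Cf Cg n; exact: CkM. Qed.

Lemma Coo_comp k A (B : set 'rV[R]_k) (F : 'rV[R]_m -> 'rV[R]_k)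
    (f : 'rV[R]_k -> R) :
  open A -> (forall x, A x -> B (F x)) ->
  (forall a, Coo A (fun x => F x ord0 a)) -> Coo B f -> Coo A (f \o F).
Proof. by move=> oA AB CF Cf n; apply: Ck_comp (Cf n) => // a; exact: CF. Qed.

End Smooth.

(** * Functions flat at the origin *)

Section FlatFunctions.
Variable R : realType.
Implicit Types (P : {poly R}) (y : R).

(* The family P(1/y) exp(-1/y) is closed under differentiation, so that the
   induction over the order of smoothness runs over all P at once. *)
Definition flat P y : R := if 0 < y then P.[y^-1] * expR (- y^-1) else 0.

(** With z = 1/y one has d/dy = - z^2 d/dz, and this operator sends P(z) exp(-z) to z^2 (P - P')(z)
    exp(-z). *)
Definition flat_deriv P : {poly R} := 'X ^+ 2 * (P - P^`()).

(** Induction on [P] for all [k] at once: in [P * 'X + c] the factor z of the first summand is moved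
    into the power, and the constant is handled by z^k <= k! exp(z), read off the exponential
    series. *)
Lemma horner_expR_bound P k : exists C : R,
  forall z, 0 < z -> `|P.[z]| * z ^+ k * expR (- z) <= C.
Proof.
elim/poly_ind: P k => [|P c IH] k.
  by exists 0 => z _; rewrite horner0 normr0 !mul0r.
have [C HC] := IH k.+1; exists (C + `|c| * k`!%:R * k.+1%:R) => z z0.
have zk0 : 0 <= z ^+ k by rewrite exprn_ge0 // ltW.
have eP : 0 <= expR (- z) by exact: expR_ge0.
rewrite hornerMXaddC.
apply: (@le_trans _ _ (`|P.[z]| * z ^+ k.+1 * expR (- z)
                       + `|c| * (z ^+ k * expR (- z)))).
  rewrite mulrA -mulrDl ler_wpM2r // exprS mulrA -mulrDl ler_wpM2r //.
  by rewrite (le_trans (ler_normD _ _)) // normrM (gtr0_norm z0).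
apply: lerD; first exact: HC.
rewrite -mulrA ler_wpM2l //.
have zk : z ^+ k / k`!%:R <= expR z.
  case: k {IH HC zk0} => [|k].
    by rewrite expr0 fact0 divr1 -expR0 ler_expR ltW.
  by apply: le_trans (expR_ge1Dxn k (ltW z0)); rewrite lerDr.
have k0 : 0 < k`!%:R :> R by rewrite ltr0n fact_gt0.
move: zk; rewrite ler_pdivrMr // => zk.
rewrite expRN ler_pdivrMr ?expR_gt0 //; apply: (le_trans zk).
rewrite mulrC ler_wpM2r ?expR_ge0 // ler_peMr ?ler1n //; exact: ltW.
Qed.

(** This is the case k = 2 of the previous bound at z = 1/y. Quadratic decay at 0 is what makes the
    derivative vanish there. *)
Lemma flat_bound P : exists C : R, forall y, `|flat P y| <= C * y ^+ 2.
Proof.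
have [C HC] := horner_expR_bound P 2.
have C0 : 0 <= C.
  by apply: le_trans (HC 1 ltr01); rewrite !mulr_ge0 ?expR_ge0 ?exprn_ge0.
exists C => y; rewrite /flat; case: ltP => y0.
  rewrite normrM (ger0_norm (expR_ge0 _)).
  have := HC y^-1; rewrite invr_gt0 => /(_ y0).
  by rewrite mulrAC exprVn ler_pdivrMr // exprn_gt0.
by rewrite normr0 mulr_ge0 // exprn_even_ge0.
Qed.

Lemma is_derive_flat P y : is_derive y 1 (flat P) (flat (flat_deriv P) y).
Proof.
have [y0|y0|->] := ltgtP y 0.
- have -> : flat (flat_deriv P) y = 0 by rewrite /flat ltNge (ltW y0).
  have fl0 : \near y, cst 0 y = flat P y.
    by near do rewrite /flat ltNge ltW //; exact: lt_nbhsl.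
  exact: near_eq_is_derive fl0 _.
- have fl0 : \near y, ((horner P * (expR \o -%R)) \o GRing.inv) y = flat P y.
    near=> z; rewrite /flat ifT //; near: z; exact: lt_nbhsr.
  apply: near_eq_is_derive fl0 _.
  have yn0 : y != 0 by rewrite gt_eqF.
  have dV : is_derive y 1 (GRing.inv : R -> R) (- y ^- 2 *: 1).
    exact: (is_deriveV (f := idfun)).
  have dN : is_derive y^-1 1 (-%R : R -> R) (-1).
    exact: (is_deriveN (f := idfun)).
  have dE := is_derive1_comp (is_derive_expR (- y^-1)) dN.
  have dP := is_deriveM (is_derive_poly P y^-1) dE.
  apply: is_derive_eq (is_derive1_comp dP dV) _.
  rewrite /flat y0 /flat_deriv hornerM hornerXn hornerD hornerN /=.
  rewrite /GRing.scale /= -exprVn; ring.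
(* At 0 the difference quotient is bounded by a multiple of |h|, so it tends to 0. *)
- have [C HC] := flat_bound P.
  have f0 : flat P 0 = 0 by rewrite /flat ltxx.
  have -> : flat (flat_deriv P) 0 = 0 by rewrite /flat ltxx.
  have lim0 : (fun h : R => h^-1 *: ((flat P \o shift 0) (h *: 1) - flat P 0))
      @ 0^' --> 0.
    apply/cvgr0Pnorm_lt => e e0; near=> h.
    have h0 : h != 0 by near: h; exact: nbhs_dnbhs_neq.
    rewrite /= addr0 f0 subr0 /GRing.scale /= mulr1 normrM normfV.
    rewrite ltr_pdivrMl ?normr_gt0 //; apply: le_lt_trans (HC h) _.
    rewrite -[h ^+ 2]ger0_norm ?exprn_even_ge0 // normrX expr2 mulrCA.
    rewrite ltr_pM2l ?normr_gt0 //.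
    (* Adding 1 keeps the factor positive, so that [e] can be divided by it. *)
    apply: (@le_lt_trans _ _ ((`|C| + 1) * `|h|)).
      by rewrite ler_wpM2r // (le_trans (ler_norm C)) // lerDl.
    rewrite mulrC -ltr_pdivlMr ?ltr_wpDl //.
    by near: h; apply: dnbhs0_lt; rewrite divr_gt0 // ltr_wpDl.
  apply: DeriveDef; last by apply: cvg_lim lim0; exact: norm_hausdorff.
  by apply/cvg_ex; exists 0; exact: lim0.
Unshelve. all: by end_near. Qed.

Lemma differentiable_flat P y : differentiable (flat P) y.
Proof. by apply/derivable1_diffP; have [] := is_derive_flat P y. Qed.

Lemma Coo_flat m (A : set 'rV[R]_m) (l : 'rV[R]_m -> R) P :
  open A -> Coo A l -> Coo A (flat P \o l).
Proof.
move=> oA Cl n; elim: n P => [|n IH] P.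
  move=> x Ax; apply: continuous_comp.
    exact/differentiable_continuous/(Coo_differentiable Cl).
  exact/differentiable_continuous/differentiable_flat.
have dl x (Ax : A x) := Coo_differentiable Cl Ax.
have dfl := differentiable_flat P.
split=> [x Ax|v]; first by apply: differentiable_comp; [exact: dl|exact: dfl].
have := CkM oA (Coo_derive v Cl n) (IH (flat_deriv P)).
apply: Ck_eq => // x Ax.
rewrite (deriveE _ (differentiable_comp (dl x Ax) (dfl _))).
rewrite diff_comp //=; last exact: dl.
rewrite diff1E // derive1E -deriveE; last exact: dl.
by have [_ ->] := is_derive_flat P (l x).
Qed.
End FlatFunctions.

(** * Bump functions with support in a cube *)

Section Bump.
Variables (R : realType) (m : nat).
Implicit Types (A : set 'rV[R]_m) (c x : 'rV[R]_m) (r : R).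

Lemma Coo_prod A (I : finType) (F : I -> 'rV[R]_m -> R) : open A ->
  (forall j, Coo A (F j)) -> Coo A (fun x => \prod_j F j x).
Proof.
move=> oA CF; elim: (index_enum I) => [|j s IH].
  by under eq_fun do rewrite big_nil; exact: Coo_cst.
by under eq_fun do rewrite big_cons; exact: CooM.
Qed.

(** [flat 1 y] is exp(-1/y) for y > 0 and 0 otherwise. The two factors of index [a] are thus both
    nonzero exactly when the coordinates [a] of [x] and [c] differ by less than [r]. *)
Definition bump c r x : R :=
  \prod_a (flat 1 (r + (x ord0 a - c ord0 a)) *
           flat 1 (r - (x ord0 a - c ord0 a))).

Lemma Coo_coord A (a : 'I_m) : Coo A (fun x => x ord0 a).
Proof. by move=> n; exact: Ck_coord. Qed.

Lemma Coo_bump c r : Coo setT (bump c r).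
Proof.
have oT : open [set: 'rV[R]_m] by exact: openT.
have CB a : Coo setT (fun x => x ord0 a - c ord0 a).
  by apply: CooD => //; [exact: Coo_coord|exact: Coo_cst].
apply: Coo_prod => // a; apply: CooM => //;
  apply: (Coo_flat (l := fun x => _)) => //.
  by apply: CooD => //; exact: Coo_cst.
apply: CooD => //; first exact: Coo_cst.
under eq_fun do rewrite -mulN1r; apply: CooM => //; exact: Coo_cst.
Qed.

Lemma bump_center c r : 0 < r -> bump c r c != 0.
Proof.
move=> r0; apply/prodf_neq0 => a _; rewrite subrr subr0 addr0 /flat r0.
by rewrite hornerC mul1r mulf_neq0 // gt_eqF // expR_gt0.
Qed.

Lemma bump_support c r x : bump c r x != 0 ->
  forall a, `[c ord0 a - r, c ord0 a + r]%classic (x ord0 a).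
Proof.
move=> /prodf_neq0 H a; have := H a isT; rewrite mulf_eq0 negb_or /flat.
case: ltP => [h1|]; last by rewrite eqxx.
case: ltP => [h2 _|]; last by rewrite eqxx andbF.
by rewrite /= in_itv /=; apply/andP; split; apply: ltW; lra.
Qed.

Lemma bump_exists A c : open A -> A c -> exists (f : 'rV[R]_m -> R) K,
  [/\ Coo setT f, f c != 0, compact K, K `<=` A & forall x, ~ K x -> f x = 0].
Proof.
move=> oA Ac; have /nbhs_ballP[e /= e0 eA] := open_nbhs_nbhs (conj oA Ac).
(* Balls of row vectors are defined entry by entry, so the closed cube of half-side e/2 lies in the
   ball of radius e; it is compact as a product of segments. *)
exists (bump c (e / 2)), [set x : 'rV[R]_m | forall a,
  `[c ord0 a - e / 2, c ord0 a + e / 2]%classic (x ord0 a)]; split.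
- exact: Coo_bump.
- by apply: bump_center; rewrite divr_gt0.
- apply: (rV_compact (T := R)
    (A := fun a => `[c ord0 a - e / 2, c ord0 a + e / 2]%classic)) => a.
  exact: segment_compact.
- move=> x Kx; apply: eA; split=> // i a; rewrite ord1.
  have := Kx a; rewrite /= in_itv /= => /andP[h1 h2].
  by rewrite /ball /= ltr_distlC; apply/andP; split; lra.
- by move=> x nK; apply/eqP; apply: contra_notT nK; exact: bump_support.
Qed.

End Bump.

(** * Smooth functions on a manifold *)

Section SmoothFunctions.
Variables (R : realType) (m : nat) (M : manifold R m).
Implicit Types (c : chart R m M) (V W : set M) (f g : M -> R) (p q : M).

Lemma chartK c p : atlas c -> dom c p -> coo_inv c (coo c p) = p.
Proof. by move=> /atlas_chart[_ _ + _ _]; exact. Qed.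

Lemma open_dom c : atlas c -> open (dom c).
Proof. by move=> /atlas_chart[]. Qed.

(** [coo_inv c] is continuous on the image of the chart, so it sends all points near [coo c p] back
    into [V]. *)
Lemma open_chart_image c V : atlas c -> open V ->
  open (coo c @` (V `&` dom c)).
Proof.
move=> ac oV; have [_ oc _ _ cinv] := atlas_chart ac.
rewrite openE => _ [p [Vp cp] <-].
have im : (coo c @` dom c) (coo c p) by exists p.
have nV : nbhs (coo_inv c (coo c p)) V.
  by rewrite chartK //; exact: open_nbhs_nbhs.
have nim : nbhs (coo c p) (coo c @` dom c) by exact: open_nbhs_nbhs.
rewrite /interior; near=> x.
have [q cq xq] : (coo c @` dom c) x by near: x.
exists q => //; split=> //; rewrite -(chartK ac cq) xq.
by near: x; exact: (cinv _ im).
Unshelve. all: by end_near. Qed.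

Lemma smooth_on_locality V f :
  (forall p, V p -> exists2 W, W p & smooth_on W f) -> smooth_on V f.
Proof.
move=> H c ac; apply: Coo_locality => _ [p [/H [W Wp Wf] cp] <-].
by exists (coo c @` (W `&` dom c)); [exists p|exact: Wf].
Qed.

Lemma smooth_on_sub V W f : W `<=` V -> smooth_on V f -> smooth_on W f.
Proof. by move=> WV Vf; apply: smooth_on_locality => p /WV Vp; exists V. Qed.

Lemma smooth_on_eq V f g : open V -> (forall p, V p -> f p = g p) ->
  smooth_on V f -> smooth_on V g.
Proof.
move=> oV fg Vf c ac; apply: Coo_eq (Vf c ac); first exact: open_chart_image.
by move=> _ [p [Vp cp] <-] /=; rewrite chartK // fg.
Qed.

Lemma smooth_on_cst V (a : R) : smooth_on V (fun=> a).
Proof. by move=> c ac; exact: Coo_cst. Qed.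

Lemma smooth_onD V f g : open V -> smooth_on V f -> smooth_on V g ->
  smooth_on V (fun p => f p + g p).
Proof.
move=> oV Vf Vg c ac; apply: CooD; [|exact: Vf|exact: Vg].
exact: open_chart_image.
Qed.

Lemma smooth_onM V f g : open V -> smooth_on V f -> smooth_on V g ->
  smooth_on V (fun p => f p * g p).
Proof.
move=> oV Vf Vg c ac; apply: CooM; [|exact: Vf|exact: Vg].
exact: open_chart_image.
Qed.

Lemma smooth_on_at V f p : open V -> V p -> smooth_on V f -> smooth_at p f.
Proof. by exists V. Qed.

Lemma smooth_at_eq V f g p : open V -> V p -> (forall q, V q -> f q = g q) ->
  smooth_at p f -> smooth_at p g.
Proof.
move=> oV Vp fg [W [oW Wp Wf]]; exists (V `&` W); split=> //.
  exact: openI.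
apply: (@smooth_on_eq _ f); first exact: openI.
  by move=> q [Vq _]; exact: fg.
by apply: smooth_on_sub Wf => q [].
Qed.

Lemma smooth_atD f g p : smooth_at p f -> smooth_at p g ->
  smooth_at p (fun q => f q + g q).
Proof.
move=> [V [oV Vp Vf]] [W [oW Wp Wf]]; have oVW := openI oV oW.
exists (V `&` W); split=> //; apply: smooth_onD => //.
  by apply: smooth_on_sub Vf => q [].
by apply: smooth_on_sub Wf => q [].
Qed.

Lemma smooth_atM f g p : smooth_at p f -> smooth_at p g ->
  smooth_at p (fun q => f q * g q).
Proof.
move=> [V [oV Vp Vf]] [W [oW Wp Wf]]; have oVW := openI oV oW.
exists (V `&` W); split=> //; apply: smooth_onM => //.
  by apply: smooth_on_sub Vf => q [].
by apply: smooth_on_sub Wf => q [].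
Qed.

Lemma smooth_at_differentiable c f p : atlas c -> dom c p -> smooth_at p f ->
  differentiable (f \o coo_inv c) (coo c p).
Proof.
move=> ac cp [V [oV Vp Vf]]; apply: Coo_differentiable (Vf c ac) _.
by exists p.
Qed.

Lemma smooth_map_id : smooth_map (@id M).
Proof. by split=> [p|c d ac ad]; [exact: cvg_id|exact: atlas_compatible]. Qed.

Lemma smooth_on_coord c a : atlas c ->
  smooth_on (dom c) (fun p => coo c p ord0 a).
Proof.
move=> ac d ad; have := atlas_compatible ad ac a.
by apply: Coo_sub; rewrite setIC.
Qed.

End SmoothFunctions.

(** * Composition with smooth maps between manifolds *)

Section SmoothMaps.
Variables (R : realType) (m k : nat) (M : manifold R m) (N : manifold R k).
Variables (F : M -> N) (sF : smooth_map F).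

Lemma open_preimage W : open W -> open (F @^-1` W).
Proof. by move: W; apply/continuousP; exact: sF.1. Qed.

(** In charts, [f \o F] is the expression of [f] in [d] composed with that of [F]. For the identity
    map this is the change of charts. *)
Lemma Coo_transition c d (W : set N) f : atlas c -> atlas d -> open W ->
  W `<=` dom d -> Coo (coo d @` W) (f \o coo_inv d) ->
  Coo (coo c @` (F @^-1` W `&` dom c)) (f \o F \o coo_inv c).
Proof.
move=> ac ad oW Wd CW.
have oA : open (coo c @` (F @^-1` W `&` dom c)).
  by apply: open_chart_image => //; exact: open_preimage.
have CF a : Coo (coo c @` (F @^-1` W `&` dom c))
    (fun x => coo d (F (coo_inv c x)) ord0 a).
  apply: Coo_sub (sF.2 c d ac ad a) => _ [p [Wp cp] <-].
  by exists p => //; split=> //; exact: Wd.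
have := Coo_comp oA _ CF CW; move=> /(_ _) H.
apply: (Coo_eq oA _ (H _)) => [x [p [Wp cp] <-]|x [p [Wp cp] <-]] /=.
  by rewrite !chartK //; exact: Wd.
by rewrite chartK //; exists (F p).
Qed.

Lemma smooth_on_comp W f : open W -> smooth_on W f ->
  smooth_on (F @^-1` W) (f \o F).
Proof.
move=> oW Wf c ac; apply: Coo_locality => _ [p [Wp cp] <-].
have [d ad dp] := atlas_cover (F p).
exists (coo c @` (F @^-1` (W `&` dom d) `&` dom c)); first by exists p.
apply: (Coo_transition (d := d)) => //.
  by apply: openI => //; exact: open_dom.
exact: Wf.
Qed.

Lemma smooth_at_comp p f : smooth_at (F p) f -> smooth_at p (f \o F).
Proof.
move=> [W [oW Wp Wf]]; exists (F @^-1` W); split=> //.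
  exact: open_preimage.
exact: smooth_on_comp.
Qed.

End SmoothMaps.

(** * Tangent vectors as derivations *)

Section TangentVectors.
Variables (R : realType) (m : nat) (M : manifold R m).
Implicit Types (c : chart R m M) (V W : set M) (f g : M -> R) (p q : M).

(** One chart containing [W] is enough: transition maps carry smoothness to all the others. *)
Lemma smooth_on_chart c W f : atlas c -> open W -> W `<=` dom c ->
  Coo (coo c @` W) (f \o coo_inv c) -> smooth_on W f.
Proof.
move=> ac oW Wc CW d ad.
exact: (Coo_transition (smooth_map_id M) ad ac oW Wc CW).
Qed.

Lemma tvecZE (a : R) (w : tvec M) f : (a *: w) f = a * w f.
Proof. by []. Qed.

Lemma tvecDE (v w : tvec M) f : (v + w) f = v f + w f.
Proof. by []. Qed.

Lemma tvec_sumE (I : Type) (s : seq I) (w : I -> tvec M) f :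
  (\sum_(j <- s) w j) f = \sum_(j <- s) w j f.
Proof.
elim: s => [|j s IH]; first by rewrite !big_nil.
by rewrite !big_cons tvecDE IH.
Qed.

Definition frame c (a : 'I_m) (p : M) : tvec M :=
  chart_vec c p (delta_mx ord0 a).

(** On functions smooth at [p] this is linearity of the differential; on all others both sides take
    the default value 0. *)
Lemma chart_vec_row c p v : atlas c -> dom c p ->
  chart_vec c p v = \sum_a v ord0 a *: frame c a p.
Proof.
move=> ac cp; apply/funext => f; rewrite tvec_sumE /frame /chart_vec.
case: asboolP => sf; last first.
  by rewrite big1 // => a _; rewrite tvecZE asboolF // mulr0.
have df := smooth_at_differentiable ac cp sf.
rewrite deriveE // {1}[v]row_sum_delta linear_sum.
apply: eq_bigr => a _; rewrite tvecZE asboolT //.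
by rewrite linearZ -deriveE.
Qed.

Lemma frame_tangent c a p : atlas c -> dom c p -> tangent p (frame c a p).
Proof. by move=> ac cp; exists c, (delta_mx ord0 a). Qed.

Lemma tangent_row c p (u : 'I_m -> R) : atlas c -> dom c p ->
  tangent p (\sum_a u a *: frame c a p).
Proof.
move=> ac cp; exists c, (\row_a u a); split=> //.
by rewrite chart_vec_row //; apply: eq_bigr => a _; rewrite mxE.
Qed.

Lemma tangent_nonsmooth p w f : tangent p w -> ~ smooth_at p f -> w f = 0.
Proof. by move=> [c [v [_ _ ->]]] nf; rewrite /chart_vec; case: asboolP. Qed.

(** Both the derivative and the test that selects the default value depend only on the germ of the
    function at [p]. *)
Lemma tangent_local p w V f g : tangent p w -> open V -> V p ->
  (forall q, V q -> f q = g q) -> w f = w g.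
Proof.
move=> [c [v [ac cp ->]]] oV Vp fg; rewrite /chart_vec.
have -> : `[< smooth_at p f >] = `[< smooth_at p g >].
  apply: asbool_equiv_eq; split; apply: smooth_at_eq oV Vp _ => // q Vq.
  by rewrite fg.
case: ifP => // _; apply: near_eq_derive.
have oA := open_chart_image ac oV.
apply: near_open oA _ _; first by exists p.
by move=> _ [q [Vq cq] <-] /=; rewrite chartK // fg.
Qed.

Lemma tangentD p w f g : tangent p w -> smooth_at p f -> smooth_at p g ->
  w (fun q => f q + g q) = w f + w g.
Proof.
move=> [c [v [ac cp ->]]] sf sg; rewrite /chart_vec !asboolT //; last first.
  exact: smooth_atD.
by rewrite -deriveD //; apply: diff_derivable; exact: smooth_at_differentiable.
Qed.

Lemma tangentM p w f g : tangent p w -> smooth_at p f -> smooth_at p g ->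
  w (fun q => f q * g q) = f p * w g + g p * w f.
Proof.
move=> [c [v [ac cp ->]]] sf sg; rewrite /chart_vec !asboolT //; last first.
  exact: smooth_atM.
have := @deriveM _ _ (f \o coo_inv c) (g \o coo_inv c) (coo c p) v.
by rewrite /= chartK //; apply; apply: diff_derivable;
  exact: smooth_at_differentiable.
Qed.

Lemma tangent_cst p w (a : R) : tangent p w -> w (fun=> a) = 0.
Proof.
move=> [c [v [ac cp ->]]]; rewrite /chart_vec asboolT; first exact: derive_cst.
by exists setT; split=> //; [exact: openT|exact: smooth_on_cst].
Qed.

Lemma smooth_at_sum p (I : Type) (s : seq I) (F : I -> M -> R) :
  (forall j, smooth_at p (F j)) -> smooth_at p (fun q => \sum_(j <- s) F j q).
Proof.
move=> sF; elim: s => [|j s IH].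
  under eq_fun do rewrite big_nil.
  by exists setT; split=> //; [exact: openT|exact: smooth_on_cst].
by under eq_fun do rewrite big_cons; exact: smooth_atD.
Qed.

Lemma tangent_sum p w (I : Type) (s : seq I) (F : I -> M -> R) :
  tangent p w -> (forall j, smooth_at p (F j)) ->
  w (fun q => \sum_(j <- s) F j q) = \sum_(j <- s) w (F j).
Proof.
move=> tw sF; elim: s => [|j s IH].
  by under eq_fun do rewrite big_nil; rewrite big_nil; exact: tangent_cst tw.
under eq_fun do rewrite big_cons.
by rewrite (tangentD tw) // ?IH ?big_cons //; exact: smooth_at_sum.
Qed.

End TangentVectors.

(** * Pushforward of tangent vectors *)

Section Pushforward.
Variables (R : realType) (m k : nat) (M : manifold R m) (N : manifold R k).
Variables (F : M -> N) (sF : smooth_map F).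

Lemma smooth_at_coord_comp d a p : atlas d -> dom d (F p) ->
  smooth_at p (fun q => coo d (F q) ord0 a).
Proof.
move=> ad dp; apply: (smooth_at_comp sF (f := fun q => coo d q ord0 a)).
by apply: smooth_on_at (smooth_on_coord a ad) => //; exact: open_dom.
Qed.

(** The chain rule in charts: the coefficients are the derivatives along [w] of the coordinates of
    [F]. For the identity map it expands a tangent vector in a coordinate frame. *)
Lemma pushforward_frame d p w : atlas d -> dom d (F p) -> tangent p w ->
  pushforward F p w = \sum_a w (fun q => coo d (F q) ord0 a) *: frame d a (F p).
Proof.
move=> ad dp [c [v [ac cp ->]]]; apply/funext => f; rewrite tvec_sumE.
rewrite /pushforward; case: asboolP => sf; last first.
  rewrite big1 // => a _; rewrite tvecZE (tangent_nonsmooth _ sf) ?mulr0 //.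
  exact: frame_tangent.
have sfF := smooth_at_comp sF sf.
rewrite /chart_vec asboolT //.
pose G x := coo d (F (coo_inv c x)).
have GE : G (coo c p) = coo d (F p) by rewrite /G chartK.
have oV : open (F @^-1` dom d) by apply: open_preimage => //; exact: open_dom.
(* [coo_inv d] undoes [coo d] only over [dom d], so the two functions agree near the point, which
   suffices for the derivative. *)
transitivity ('D_v ((f \o coo_inv d) \o G) (coo c p)).
  apply: near_eq_derive; apply: near_open (open_chart_image ac oV) _ _.
    by exists p.
  by move=> _ [q [dq cq] <-] /=; rewrite /G !chartK.
rewrite chain_rule; last 2 first.
- move=> a.
  exact: (smooth_at_differentiable ac cp (smooth_at_coord_comp a ad dp)).
- by rewrite GE; exact: smooth_at_differentiable.
apply: eq_bigr => a _; rewrite tvecZE /frame /chart_vec asboolT //; last first.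
  exact: smooth_at_coord_comp.
by rewrite asboolT // GE.
Qed.

Lemma pushforward_tangent p w : tangent p w ->
  tangent (F p) (pushforward F p w).
Proof.
move=> tw; have [d ad dp] := atlas_cover (F p).
by rewrite (pushforward_frame ad dp tw); exact: tangent_row.
Qed.

Lemma pushforwardP p (a : R) (v w : tvec M) :
  pushforward F p (a *: v + w) = a *: pushforward F p v + pushforward F p w.
Proof.
apply/funext => f; rewrite tvecDE tvecZE /pushforward.
by case: ifP => // _; rewrite mulr0 addr0.
Qed.

End Pushforward.

(** * Linear structure of the tangent spaces *)

Section TangentSpace.
Variables (R : realType) (m : nat) (M : manifold R m).
Implicit Types (c : chart R m M) (p : M) (v w : tvec M).

Lemma pushforward_id p w : tangent p w -> pushforward (@id M) p w = w.
Proof.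
move=> tw; apply/funext => f; rewrite /pushforward.
by case: asboolP => // /(tangent_nonsmooth tw) ->.
Qed.

Lemma tangent_frame c p w : atlas c -> dom c p -> tangent p w ->
  w = \sum_a w (fun q => coo c q ord0 a) *: frame c a p.
Proof.
move=> ac cp tw; rewrite -[LHS](pushforward_id tw).
by rewrite (pushforward_frame (smooth_map_id M) ac).
Qed.

(** [v] and [w] may come from different charts, so both are first expanded in the frame of one chart
    around [p]. *)
Lemma tangentP p (a : R) v w : tangent p v -> tangent p w ->
  tangent p (a *: v + w).
Proof.
have [c ac cp] := atlas_cover p.
move=> /(tangent_frame ac cp) -> /(tangent_frame ac cp) ->.
rewrite scaler_sumr -big_split /=.
under eq_bigr do rewrite scalerA -scalerDl; exact: tangent_row.
Qed.

Lemma tangent0 p : tangent p 0.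
Proof.
have [c ac cp] := atlas_cover p.
have := tangent_row (fun=> 0) ac cp.
by rewrite big1 // => a _; rewrite scale0r.
Qed.

Lemma tangent_lc p (I : Type) (s : seq I) (u : I -> R) (e : I -> tvec M) :
  (forall j, tangent p (e j)) -> tangent p (\sum_(j <- s) u j *: e j).
Proof.
move=> te; elim: s => [|j s IH]; first by rewrite big_nil; exact: tangent0.
by rewrite big_cons; exact: tangentP.
Qed.

End TangentSpace.

(** * Vector fields along a map and their connections *)

Section FieldsAlong.
Variables (R : realType) (m k : nat) (M : manifold R m) (N : manifold R k).
Variables (F : M -> N) (sF : smooth_map F).
Implicit Types (V W : set M) (Y Z : M -> tvec N) (d : chart R k N).

Lemma field_along_sub V W Y : W `<=` V -> field_along F V Y ->
  field_along F W Y.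
Proof.
move=> WV [tY sY]; split=> [p /WV|U f oU Uf]; first exact: tY.
by apply: smooth_on_sub (sY U f oU Uf) => p [/WV].
Qed.

Lemma field_along_locality V Y :
  (forall p, V p -> exists2 W, W p & field_along F W Y) -> field_along F V Y.
Proof.
move=> H; split=> [p /H [W Wp [tY _]]|U f oU Uf]; first exact: tY.
apply: smooth_on_locality => p [/H [W Wp [_ sY]] Up].
by exists (W `&` F @^-1` U) => //; exact: sY.
Qed.

Lemma field_along_eq V Y Z : open V -> (forall p, V p -> Y p = Z p) ->
  field_along F V Y -> field_along F V Z.
Proof.
move=> oV YZ [tY sY]; split=> [p Vp|U f oU Uf].
  by rewrite -YZ //; exact: tY.
apply: smooth_on_eq (sY U f oU Uf); first exact/openI/open_preimage.
by move=> p [Vp _]; rewrite YZ.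
Qed.

Lemma field_alongP V (f : M -> R) Y Z : open V -> smooth_on V f ->
  field_along F V Y -> field_along F V Z ->
  field_along F V (fun p => f p *: Y p + Z p).
Proof.
move=> oV Vf [tY sY] [tZ sZ]; split=> [p Vp|U h oU Uh].
  by apply: tangentP; [exact: tY|exact: tZ].
have oVU : open (V `&` F @^-1` U) by exact/openI/open_preimage.
apply: (smooth_onD oVU _ (sZ U h oU Uh)).
apply: (smooth_onM oVU _ (sY U h oU Uh)).
by apply: smooth_on_sub Vf => p [].
Qed.

Lemma field_along0 V : field_along F V (fun=> 0).
Proof.
split=> [p _|U h oU Uh]; first exact: tangent0.
exact: smooth_on_cst.
Qed.

Lemma field_alongZ V (f : M -> R) Y : open V -> smooth_on V f ->
  field_along F V Y -> field_along F V (fun p => f p *: Y p).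
Proof.
move=> oV Vf VY.
apply: field_along_eq (field_alongP oV Vf VY (field_along0 V)) => //.
by move=> p _; rewrite addr0.
Qed.

Lemma field_along_lc V (I : Type) (s : seq I) (f : I -> M -> R)
    (E : I -> M -> tvec N) : open V -> (forall j, smooth_on V (f j)) ->
  (forall j, field_along F V (E j)) ->
  field_along F V (fun p => \sum_(j <- s) f j p *: E j p).
Proof.
move=> oV Vf VE; elim: s => [|j s IH].
  by under eq_fun do rewrite big_nil; exact: field_along0.
by under eq_fun do rewrite big_cons; exact: field_alongP.
Qed.

Lemma field_along_comp (U : set N) (Y : N -> tvec N) :
  open U -> vfield U Y -> field_along F (F @^-1` U) (Y \o F).
Proof.
move=> oU [tY sY]; split=> [p|W f oW Wf]; first exact: tY.
exact: (smooth_on_comp sF (openI oU oW) (sY W f oW Wf)).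
Qed.

Lemma field_along_pushforward V (X : M -> tvec M) : open V -> vfield V X ->
  field_along F V (fun p => pushforward F p (X p)).
Proof.
move=> oV [tX sX]; split=> [p Vp|U f oU Uf].
  by apply: pushforward_tangent => //; exact: tX.
have oFU := open_preimage sF oU.
apply: smooth_on_eq (sX _ _ oFU (smooth_on_comp sF oU Uf)).
  exact: openI.
move=> p [_ Up]; rewrite /Defs.pushforward asboolT //.
exact: smooth_on_at Uf.
Qed.

Lemma field_along_frame d V Y p : atlas d -> field_along F V Y -> V p ->
  dom d (F p) ->
  Y p = \sum_a Y p (fun q => coo d q ord0 a) *: frame d a (F p).
Proof. by move=> ad [tY _] Vp dp; apply: tangent_frame => //; exact: tY. Qed.

Lemma field_along_coord d V Y a : atlas d -> field_along F V Y ->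
  smooth_on (V `&` F @^-1` dom d) (fun p => Y p (fun q => coo d q ord0 a)).
Proof.
by move=> ad [_ sY]; apply: sY; [exact: open_dom|exact: smooth_on_coord].
Qed.

Variable D : (M -> tvec M) -> (M -> tvec N) -> (M -> tvec N).
Hypothesis HD : connection_along F D.

Lemma connection_lc V (I : Type) (s : seq I) X (f : I -> M -> R)
    (E : I -> M -> tvec N) p : open V -> V p -> vfield V X ->
  (forall j, smooth_on V (f j)) -> (forall j, field_along F V (E j)) ->
  D X (fun q => \sum_(j <- s) f j q *: E j q) p =
  \sum_(j <- s) (X p (f j) *: E j p + f j p *: D X (E j) p).
Proof.
move=> oV Vp VX Vf VE; have [_ _ _ DD DM] := HD oV.
elim: s => [|j s IH].
  under eq_fun do rewrite big_nil; rewrite big_nil.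
  (* Additivity at 0 + 0 forces the derivative of the zero field to vanish. *)
  have := DD X _ _ VX (field_along0 V) (field_along0 V) p Vp.
  under eq_fun do rewrite addr0.
  by rewrite -[LHS]addr0 => /addrI <-.
under eq_fun do rewrite big_cons; rewrite big_cons -IH -DM //.
by apply: (DD X (fun q => f j q *: E j q)) => //;
  [exact: field_alongZ|exact: field_along_lc].
Qed.

End FieldsAlong.

(** * Coordinate frames *)

Section Frames.
Variables (R : realType) (m : nat) (M : manifold R m).

(** Applied to a smooth function, a frame field is a partial derivative of its coordinate
    expression. *)
Lemma vfield_frame (c : chart R m M) a : atlas c -> vfield (dom c) (frame c a).
Proof.
move=> ac; split=> [p|W f oW Wf]; first exact: frame_tangent.
have oWc : open (dom c `&` W) by apply: openI => //; exact: open_dom.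
apply: (@smooth_on_chart _ _ _ c) => //.
have oA : open (coo c @` (dom c `&` W)).
  by rewrite setIC; exact: open_chart_image.
apply: Coo_eq (Coo_sub _ (Coo_derive (delta_mx ord0 a) (Wf c ac))) => //.
- move=> _ [p [cp Wp] <-] /=; rewrite chartK // /frame /chart_vec asboolT //.
  exact: smooth_on_at Wf.
- by rewrite setIC.
Qed.

End Frames.

(** * Duality of the connections for fields along the hypersurface *)

Section Duality.
Variables (R : realType) (m k : nat) (Mb : manifold R m) (M : manifold R k).
Variables (g : Mb -> tvec Mb -> tvec Mb -> R) (Hg : semi_riemannian g).

Lemma metric_lin p (u v w : tvec Mb) a : tangent p u -> tangent p v ->
  tangent p w -> g p (a *: u + v) w = a * g p u w + g p v w.
Proof. by case: Hg => H _ _ _ _; exact: H. Qed.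

Lemma metricC p (u v : tvec Mb) : tangent p u -> tangent p v ->
  g p u v = g p v u.
Proof. by case: Hg => _ H _ _ _; exact: H. Qed.

Lemma metricD p (u v w : tvec Mb) : tangent p u -> tangent p v ->
  tangent p w -> g p (u + v) w = g p u w + g p v w.
Proof. by move=> tu tv tw; rewrite -[u in LHS]scale1r metric_lin ?mul1r. Qed.

Lemma metric0l p (w : tvec Mb) : tangent p w -> g p 0 w = 0.
Proof.
move=> tw; have := metric_lin (-1) (tangent0 p) (tangent0 p) tw.
by rewrite scaler0 addr0 mulN1r addNr.
Qed.

Lemma metric_suml p (I : Type) (s : seq I) (u : I -> R) (e : I -> tvec Mb) w :
  (forall j, tangent p (e j)) -> tangent p w ->
  g p (\sum_(j <- s) u j *: e j) w = \sum_(j <- s) u j * g p (e j) w.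
Proof.
move=> te tw; elim: s => [|j s IH]; first by rewrite !big_nil metric0l.
by rewrite !big_cons metric_lin // ?IH //; exact: tangent_lc.
Qed.

Lemma metric_sumr p (I : Type) (s : seq I) (u : I -> R) (e : I -> tvec Mb) w :
  (forall j, tangent p (e j)) -> tangent p w ->
  g p w (\sum_(j <- s) u j *: e j) = \sum_(j <- s) u j * g p w (e j).
Proof.
move=> te tw; rewrite metricC //; last exact: tangent_lc.
by rewrite metric_suml //; apply: eq_bigr => j _; rewrite metricC.
Qed.

Variables (nab nabs : (Mb -> tvec Mb) -> (Mb -> tvec Mb) -> (Mb -> tvec Mb)).
Hypothesis dual : forall V X Y Z, open V -> vfield V X -> vfield V Y ->
  vfield V Z -> forall p, V p ->
  X p (fun q => g q (Y q) (Z q)) =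
  g p (nab X Y p) (Z p) + g p (Y p) (nabs X Z p).
Variables (i : M -> Mb) (si : smooth_map i).
Variables (D Ds : (M -> tvec M) -> (M -> tvec Mb) -> (M -> tvec Mb)).
Hypothesis HD : pullback_connection i nab D.
Hypothesis HDs : pullback_connection i nabs Ds.

(** Around [p] both fields are combinations of the frame fields [E a] of an ambient chart. Duality
    holds for these by restriction from the ambient manifold, and the product rule takes care of the
    coefficients. *)
Lemma pullback_duality U X Y Z p : open U -> vfield U X ->
  field_along i U Y -> field_along i U Z -> U p ->
  X p (fun q => g (i q) (Y q) (Z q)) =
  g (i p) (D X Y p) (Z p) + g (i p) (Y p) (Ds X Z p).
Proof.
move=> oU UX UY UZ Up; have [d ad dp] := atlas_cover (i p).
have od := open_dom ad.
pose V := U `&` i @^-1` dom d.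
have oV : open V by apply: openI => //; exact: open_preimage.
have Vp : V p by [].
have VU : V `<=` U by move=> q [].
have VX := field_along_sub VU UX.
have VY := field_along_sub VU UY; have VZ := field_along_sub VU UZ.
pose y a q := Y q (fun q => coo d q ord0 a).
pose z a q := Z q (fun q => coo d q ord0 a).
pose E a := frame d a \o i.
pose h a b q := g q (frame d a q) (frame d b q).
have Vy a : smooth_on V (y a) by exact: field_along_coord.
have Vz a : smooth_on V (z a) by exact: field_along_coord.
have VE a : field_along i V (E a).
  apply: field_along_sub (field_along_comp si od (vfield_frame a ad)).
  by move=> q [].
have sh a b : smooth_on (dom d) (h a b).
  by case: Hg => _ _ _ + _; apply=> //; exact: vfield_frame.
have Vh a b : smooth_on V (h a b \o i).
  by apply: smooth_on_sub (smooth_on_comp si od (sh a b)) => q [].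
have YE q : V q -> Y q = \sum_a y a q *: E a q.
  by move=> [Uq dq]; exact: (field_along_frame ad UY).
have ZE q : V q -> Z q = \sum_a z a q *: E a q.
  by move=> [Uq dq]; exact: (field_along_frame ad UZ).
have tE q a : V q -> tangent (i q) (E a q).
  by move=> [_ dq]; exact: frame_tangent.
(* [Xb] is the ambient field with constant coefficients whose value at [i p] is the pushforward of
   [X p]; the pullback condition asks for such an extension at that point only. *)
pose Xb q := \sum_a X p (fun q => coo d (i q) ord0 a) *: frame d a q.
have dXb : vfield (dom d) Xb.
  apply: (field_along_lc (smooth_map_id _)) => // a; last exact: vfield_frame.
  exact: smooth_on_cst.
have tX : tangent p (X p) by case: UX => + _; exact.
have XbE : Xb (i p) = pushforward i p (X p).
  by rewrite (pushforward_frame si ad dp tX).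
have DE a : D X (E a) p = nab Xb (frame d a) (i p).
  by apply: (HD.2 V (dom d)) => //; exact: vfield_frame.
have DsE a : Ds X (E a) p = nabs Xb (frame d a) (i p).
  by apply: (HDs.2 V (dom d)) => //; exact: vfield_frame.
have tDE a : tangent (i p) (D X (E a) p).
  by have [H _ _ _ _] := HD.1 V oV; case: (H _ _ VX (VE a)) => + _; exact.
have tDsE a : tangent (i p) (Ds X (E a) p).
  by have [H _ _ _ _] := HDs.1 V oV; case: (H _ _ VX (VE a)) => + _; exact.
have Xh a b : X p (h a b \o i) =
    g (i p) (D X (E a) p) (E b p) + g (i p) (E a p) (Ds X (E b) p).
  rewrite DE DsE -(dual od dXb (vfield_frame a ad) (vfield_frame b ad) dp) XbE.
  by rewrite /Defs.pushforward asboolT //; exact: smooth_on_at (sh a b).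
have DY : D X Y p = \sum_a (X p (y a) *: E a p + y a p *: D X (E a) p).
  rewrite -(connection_lc si HD.1 _ oV Vp VX Vy VE).
  have [_ H _ _ _] := HD.1 V oV; apply: H => //.
  exact: field_along_lc.
have DZ : Ds X Z p = \sum_a (X p (z a) *: E a p + z a p *: Ds X (E a) p).
  rewrite -(connection_lc si HDs.1 _ oV Vp VX Vz VE).
  have [_ H _ _ _] := HDs.1 V oV; apply: H => //.
  exact: field_along_lc.
have gE q : V q -> g (i q) (Y q) (Z q) =
    \sum_a \sum_b y a q * (z b q * (h a b \o i) q).
  move=> Vq; rewrite YE // ZE // metric_suml //; last first.
  - by apply: tangent_lc => a; exact: tE.
  - by move=> a; exact: tE.
  apply: eq_bigr => a _; rewrite metric_sumr ?mulr_sumr //; last exact: tE.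
  by move=> b; exact: tE.
rewrite (tangent_local tX oV Vp gE).
have sat f : smooth_on V f -> smooth_at p f by exact: smooth_on_at.
have szh a b : smooth_at p (fun q => z b q * (h a b \o i) q).
  by apply: smooth_atM; apply: sat.
have syzh a b : smooth_at p (fun q => y a q * (z b q * (h a b \o i) q)).
  by apply: smooth_atM => //; apply: sat.
have tEp a : tangent (i p) (E a p) by exact: tE.
have tlc (u e : 'I_m -> _) : (forall a, tangent (i p) (e a)) ->
    tangent (i p) (\sum_a u a *: e a) by exact: tangent_lc.
have DYZ : g (i p) (D X Y p) (Z p) = \sum_a \sum_b
    (X p (y a) * (z b p * h a b (i p)) +
     y a p * (z b p * g (i p) (D X (E a) p) (E b p))).
  rewrite DY ZE // big_split /= metricD ?metric_suml //; try exact: tlc.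
  rewrite -big_split /=; apply: eq_bigr => a _.
  by rewrite !metric_sumr // !mulr_sumr -big_split.
have YDZ : g (i p) (Y p) (Ds X Z p) = \sum_a \sum_b
    (y a p * (X p (z b) * h a b (i p)) +
     y a p * (z b p * g (i p) (E a p) (Ds X (E b) p))).
  rewrite DZ YE // metric_suml //; last first.
    by rewrite big_split /= -[X in X + _]scale1r; apply: tangentP; exact: tlc.
  apply: eq_bigr => a _; rewrite big_split /= metricC //; last first.
    by rewrite -[X in X + _]scale1r; apply: tangentP; exact: tlc.
  rewrite metricD //; try exact: tlc.
  rewrite !metric_suml // -big_split mulr_sumr /=.
  apply: eq_bigr => b _; rewrite mulrDr.
  by rewrite (metricC (tEp b) (tEp a)) (metricC (tDsE b) (tEp a)).
(* The identity is checked for each pair of indices: the product rule gives three terms, and [Xh]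
   splits the one containing the derivative of [h], which yields the four terms of [DYZ] and
   [YDZ]. *)
rewrite (tangent_sum _ tX); last by move=> a; exact: smooth_at_sum.
rewrite DYZ YDZ -big_split; apply: eq_bigr => a _.
rewrite (tangent_sum _ tX) // -big_split; apply: eq_bigr => b _ /=.
rewrite (tangentM tX (sat _ (Vy a)) (szh a b)).
rewrite (tangentM tX (sat _ (Vz b)) (sat _ (Vh a b))) Xh /=.
ring.
Qed.
End Duality.

(** * Distributions and extension of their vectors to global sections *)

Section Distributions.
Variables (R : realType) (m r : nat) (M : manifold R m).
Variables (S : M -> set (tvec M)) (HS : Defs.distribution r S).

Lemma distribution_tangent p v : S p v -> tangent p v.
Proof.
have [V [e [_ Vp Ve HV]]] := HS p; have [-> _] := HV p Vp.
move=> [a ->]; apply: tangent_lc => j; exact: (Ve j).1.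
Qed.

Lemma distributionP p (a : R) v w : S p v -> S p w -> S p (a *: v + w).
Proof.
have [V [e [_ Vp Ve HV]]] := HS p; have [-> _] := HV p Vp.
move=> [b ->] [c ->]; exists (fun j => a * b j + c j).
rewrite scaler_sumr -big_split; apply: eq_bigr => j _.
by rewrite /= scalerA -scalerDl.
Qed.

Lemma distribution0 p : S p 0.
Proof.
have [V [e [_ Vp Ve HV]]] := HS p; have [-> _] := HV p Vp.
by exists (fun=> 0); rewrite big1 // => j _; rewrite scale0r.
Qed.

Lemma distributionZ p (a : R) v : S p v -> S p (a *: v).
Proof.
by move=> Sv; rewrite -[_ *: _]addr0; apply: distributionP => //;
  exact: distribution0.
Qed.

Lemma distribution_lc p (I : Type) (s : seq I) (u : I -> R) (e : I -> tvec M) :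
  (forall j, S p (e j)) -> S p (\sum_(j <- s) u j *: e j).
Proof.
move=> Se; elim: s => [|j s IH]; first by rewrite big_nil; exact: distribution0.
by rewrite big_cons; exact: distributionP.
Qed.

(** A combination of a local frame is multiplied by a bump function and extended by 0. The result is
    smooth on [V] within the chart and on the complement of the compact set [L], which is open
    because [M] is Hausdorff; these two open sets cover [M]. *)
Lemma distribution_extension p s : S p s ->
  exists W, section setT S W /\ W p = s.
Proof.
have [V [e [oV Vp Ve HV]]] := HS p; have [-> _] := HV p Vp.
move=> [a ->]; have [c ac cp] := atlas_cover p.
have od := open_dom ac; have oVc : open (V `&` dom c) by exact: openI.
have oA := open_chart_image ac oV.
have Ap : (coo c @` (V `&` dom c)) (coo c p) by exists p.
have [phi [K [sphi phip cK KA phi0]]] := bump_exists oA Ap.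
pose L := coo_inv c @` K.
have cL : compact L.
  apply: continuous_compact cK; apply: continuous_in_subspaceT => x.
  rewrite inE => /KA [q [_ cq] <-].
  by have [_ _ _ _] := atlas_chart ac; apply; exists q.
have oL : open (~` L).
  by apply: closed_openC; apply: compact_closed cL; exact: manifold_hausdorff.
(* The division makes [f] equal to 1 at [p], so that [W p] is exactly [s]. *)
pose f q := phi (coo c q) / phi (coo c p).
pose W q := if `[< (V `&` dom c) q >] then f q *: \sum_j a j *: e j q else 0.
have sf : smooth_on (dom c) f.
  apply: (smooth_on_chart ac od) => //.
  have oc : open (coo c @` dom c) by have [] := atlas_chart ac.
  have := CooM oc (Coo_sub (@subsetT _ _) sphi) (Coo_cst _ (phi (coo c p))^-1).
  by apply: Coo_eq => // _ [q cq <-] /=; rewrite /f chartK.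
have WV : vfield (V `&` dom c) W.
  have h : vfield (V `&` dom c) (fun q => f q *: \sum_j a j *: e j q).
    apply: (field_alongZ (smooth_map_id _)) => //.
      by apply: smooth_on_sub sf => q [].
    apply: (field_along_lc (smooth_map_id _)) => // j.
      exact: smooth_on_cst.
    by apply: field_along_sub (Ve j) => q [].
  apply: (field_along_eq (smooth_map_id _) _ _ h) => // q Vq.
  by rewrite /W asboolT.
have WL : vfield (~` L) W.
  apply: (field_along_eq (smooth_map_id _) _ _ (field_along0 id (~` L))) => //.
  move=> q nLq; rewrite /W; case: asboolP => // -[Vq cq].
  rewrite /f phi0 ?mul0r ?scale0r // => Kq; apply: nLq.
  by exists (coo c q) => //; rewrite chartK.
exists W; split; last by rewrite /W asboolT // /f divff // scale1r.
split=> [|q _].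
  apply: field_along_locality => q _.
  have [[x Kx xq]|nLq] := pselect (L q); last by exists (~` L).
  exists (V `&` dom c) => //; rewrite -xq.
  by have [z [Vz cz] <-] := KA _ Kx; rewrite chartK.
rewrite /W; case: asboolP => [[Vq _]|_]; last exact: distribution0.
apply: distributionZ; apply: distribution_lc => j.
have [-> _] := HV q Vq; exists (fun l => (l == j)%:R).
rewrite (bigD1 j) //= eqxx scale1r big1 ?addr0 // => l /negbTE ->.
by rewrite scale0r.
Qed.

End Distributions.

(** * Screen fundamental forms in terms of the shape operators *)

Section ScreenForms.
Variables (R : realType) (n : nat) (Mb : manifold R n.+1) (M : manifold R n).
Variables (g : Mb -> tvec Mb -> tvec Mb -> R) (Hg : semi_riemannian g).

(** Symmetry of [g] exchanges the roles of the two connections, so that [screen_form] yields the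
    formula for each of the two screen forms. *)
Lemma dual_sym
    (nab nabs : (Mb -> tvec Mb) -> (Mb -> tvec Mb) -> (Mb -> tvec Mb)) :
  affine_connection nab -> affine_connection nabs ->
  (forall V X Y Z, open V -> vfield V X -> vfield V Y -> vfield V Z ->
   forall p, V p -> X p (fun q => g q (Y q) (Z q))
     = g p (nab X Y p) (Z p) + g p (Y p) (nabs X Z p)) ->
  forall V X Y Z, open V -> vfield V X -> vfield V Y -> vfield V Z ->
   forall p, V p -> X p (fun q => g q (Y q) (Z q))
     = g p (nabs X Y p) (Z p) + g p (Y p) (nab X Z p).
Proof.
move=> cn cns dual V X Y Z oV VX VY VZ p Vp.
have tf F q : vfield V F -> V q -> tangent q (F q) by move=> [+ _]; apply.
rewrite (tangent_local (g := fun q => g q (Z q) (Y q)) (tf _ _ VX Vp) oV Vp).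
  rewrite (dual V) // addrC.
  have [H _ _ _ _] := cn V oV; have [Hs _ _ _ _] := cns V oV.
  have tZ := tf _ _ (H _ _ VX VZ) Vp; have tY := tf _ _ (Hs _ _ VX VY) Vp.
  by rewrite (metricC Hg tZ) ?(metricC Hg tY) //; exact: tf.
by move=> q Vq; rewrite (metricC Hg) //; exact: tf.
Qed.

Variables (i : M -> Mb) (si : smooth_map i).

(** The derivative of g(W, N) = 0 along [X] pairs the Gauss formula of one connection with the
    Weingarten formula of its dual: [A] is the shape operator of [Ds], while [C] belongs to [D]. *)
Lemma screen_form r (S : M -> set (tvec M)) (U : set M) (xi : M -> tvec M)
    (N : M -> tvec Mb)
    (nabb nabbs : (Mb -> tvec Mb) -> (Mb -> tvec Mb) -> (Mb -> tvec Mb))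
    (D Ds : (M -> tvec M) -> (M -> tvec Mb) -> (M -> tvec Mb))
    (nab nabS : (M -> tvec M) -> (M -> tvec M) -> (M -> tvec M))
    (A : (M -> tvec M) -> (M -> tvec M)) (tau : (M -> tvec M) -> M -> R)
    (B C : (M -> tvec M) -> (M -> tvec M) -> M -> R) :
  (forall V X Y Z, open V -> vfield V X -> vfield V Y -> vfield V Z ->
   forall p, V p -> X p (fun q => g q (Y q) (Z q))
     = g p (nabb X Y p) (Z p) + g p (Y p) (nabbs X Z p)) ->
  pullback_connection i nabb D -> pullback_connection i nabbs Ds ->
  Defs.distribution r S -> open U -> radical_section i g U xi ->
  transversal_section i g S U xi N ->
  gauss_formula i U N D nab B -> weingarten_formula i U N Ds A tau ->
  screen_decomposition S U xi nab nabS C ->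
  forall X W p, vfield U X -> section U S W -> U p ->
  C X W p = g (i p) (pushforward i p (A X p)) (pushforward i p (W p)).
Proof.
move=> dual HD HDs HS oU [[Uxi _] _] [UN HN] HG HW HC X W p UX SW Up.
have [UW WS] := SW.
have tf F q : vfield U F -> U q -> tangent q (F q) by move=> [+ _]; apply.
have tp q v : tangent q v -> tangent (i q) (pushforward i q v).
  exact: pushforward_tangent.
have tN q : U q -> tangent (i q) (N q) by case: UN => + _; apply.
have [NN Nxi NS] := HN p Up; have tNp := tN p Up.
have := pullback_duality Hg dual si HD HDs oU UX
  (field_along_pushforward si oU UW) UN Up.
have tX := tf _ _ UX Up.
rewrite (tangent_local (g := fun=> 0) tX oU Up); last first.
  move=> q Uq; have [_ _ NSq] := HN q Uq.
  by rewrite (metricC Hg) ?NSq //; [exact: WS|exact/tp/tf|exact: tN].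
rewrite (tangent_cst _ tX).
have [UnW /(_ p Up) ->] := HG X W UX UW.
have [UA /(_ p Up) ->] := HW X UX.
have [[UnS SnS] /(_ p Up) nSC] := HC X W UX SW.
have tA := tp _ _ (tf _ _ UA Up); have txi := tp _ _ (tf _ _ Uxi Up).
have tnS := tp _ _ (tf _ _ UnS Up); have tW := tp _ _ (tf _ _ UW Up).
have tnW := tp _ _ (tf _ _ UnW Up).
rewrite /along in tA tW tnW *.
(* [B X W] drops out because [N] is null, the screen part because [N] is orthogonal to it; [xi]
   pairs to 1 with [N], which leaves [C X W p]. *)
rewrite addrC [_ + B X W p *: _]addrC (metric_lin Hg) // NN mulr0 add0r.
rewrite nSC addrC [in X in X + _]addrC pushforwardP (metric_lin Hg) //.
rewrite (metricC Hg txi tNp) Nxi mulr1 (metricC Hg tnS tNp) NS; last exact: SnS.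
(* In the second pairing [tau X] drops out because [W p] is in the screen, which leaves minus the
   pairing of [A X] with [W]. *)
rewrite addr0 (metricC Hg tW); last first.
  by rewrite addrC; apply: tangentP => //; rewrite -scaleN1r -[_ *: _]addr0;
     apply: tangentP => //; exact: tangent0.
rewrite -scaleN1r (metric_lin Hg) //; last first.
  by rewrite -[_ *: _]addr0; apply: tangentP => //; exact: tangent0.
rewrite -[tau X p *: _]addr0 (metric_lin Hg) //; last exact: tangent0.
rewrite NS; last exact: WS.
rewrite (metric0l Hg) // mulr0 !addr0 mulN1r => /eqP.
by rewrite eq_sym subr_eq0 => /eqP.
Qed.

End ScreenForms.

(** * Linear combinations of sections *)

Section Sections.
Variables (R : realType) (m r : nat) (M : manifold R m).
Variables (S : M -> set (tvec M)) (HS : Defs.distribution r S).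
Variables (U : set M) (oU : open U).

(** Constant coefficients suffice to pass between the two connections and their half sum and half
    difference. *)
Lemma section_lin (a b : R) (Y Z : M -> tvec M) :
  section U S Y -> section U S Z ->
  section U S (fun p => a *: Y p + b *: Z p).
Proof.
move=> [UY SY] [UZ SZ]; split=> [|p Up].
  have cU (c : R) : smooth_on U (fun=> c) by exact: smooth_on_cst.
  apply: (field_alongP (smooth_map_id _)) => //.
  exact: (field_alongZ (smooth_map_id _)).
by apply: (distributionP HS); [exact: SY|exact/(distributionZ HS)/SZ].
Qed.

End Sections.

(** * Equivalence of the four conditions on the screen *)

Theorem theorem3p3 (R : realType) (n : nat)
  (Mb : manifold R n.+2) (g : Mb -> tvec Mb -> tvec Mb -> R)
  (nabb nabbs : (Mb -> tvec Mb) -> (Mb -> tvec Mb) -> (Mb -> tvec Mb))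
  (Hstat : statistical_manifold g nabb nabbs)
  (M : manifold R n.+1) (i : M -> Mb)
  (Hlight : lightlike_hypersurface i g)
  (S : M -> set (tvec M)) (Hscreen : screen_distribution i g S)
  (U : set M) (HU : open U)
  (xi : M -> tvec M) (Hxi : radical_section i g U xi)
  (N : M -> tvec Mb) (HN : transversal_section i g S U xi N)
  (Db Dbs : (M -> tvec M) -> (M -> tvec Mb) -> (M -> tvec Mb))
  (HDb : pullback_connection i nabb Db)
  (HDbs : pullback_connection i nabbs Dbs)
  (nab nabs : (M -> tvec M) -> (M -> tvec M) -> (M -> tvec M))
  (B Bs : (M -> tvec M) -> (M -> tvec M) -> M -> R)
  (Hgauss : gauss_formula i U N Db nab B)
  (Hgausss : gauss_formula i U N Dbs nabs Bs)
  (AN ANs : (M -> tvec M) -> (M -> tvec M))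
  (tau taus : (M -> tvec M) -> M -> R)
  (Hweingarten : weingarten_formula i U N Db ANs taus)
  (Hweingartens : weingarten_formula i U N Dbs AN tau)
  (nabS nabsS : (M -> tvec M) -> (M -> tvec M) -> (M -> tvec M))
  (C Cs : (M -> tvec M) -> (M -> tvec M) -> M -> R)
  (HC : screen_decomposition S U xi nab nabS C)
  (HCs : screen_decomposition S U xi nabs nabsS Cs) :
  [<-> parallel U S nab /\ parallel U S nabs;
       forall X W, vfield U X -> section U S W ->
                   forall p, U p -> C X W p = 0 /\ Cs X W p = 0;
       forall X, vfield U X ->
                   section U (Rad i g) (AN X) /\ section U (Rad i g) (ANs X);
       parallel U S (mean_connection nab nabs) /\
                 forall X W, vfield U X -> section U S W ->
                   section U S (difference_tensor nab nabs X W) ].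
Proof.
have [Hg [affn _] _ affns dual] := Hstat.
have duals := dual_sym Hg affn affns dual.
have [[_ si _] _] := Hlight.
have [HS _ SRad SRad0] := Hscreen.
(* [AN] is defined by the dual connection, so it is matched with [C]; likewise [ANs] with [Cs]. *)
have CE := screen_form Hg si dual HDb HDbs HS HU Hxi HN Hgauss Hweingartens HC.
have CsE :=
  screen_form Hg si duals HDbs HDb HS HU Hxi HN Hgausss Hweingarten HCs.
(* If the coefficient were nonzero, [xi p] would be a combination of two screen vectors, hence lie
   in both the screen and the radical, hence be 0. *)
have parallel0 D DS F X W p : parallel U S D ->
    screen_decomposition S U xi D DS F -> vfield U X -> section U S W ->
    U p -> F X W p = 0.
  move=> pD HF UX SW Up; have [[_ SDS] /(_ p Up) DE] := HF X W UX SW.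
  have [_ SD] := pD X W UX SW; have [[_ Rxi] xi0] := Hxi.
  apply/eqP; apply: contraT => F0; move: (xi0 p Up) => /eqP[].
  apply: (SRad0 p) (Rxi p Up).
  have -> : xi p = (F X W p)^-1 *: (-1 *: DS X W p + D X W p).
    by rewrite DE scaleN1r addKr scalerA mulVf // scale1r.
  apply: (distributionZ HS); apply: (distributionP HS); [exact: SDS|exact: SD].
(* Orthogonality is needed against every tangent vector at [p]. The radical part is orthogonal by
   symmetry of [g]; the screen part is the value of a global section, whose restriction to [U] falls
   under the hypothesis. *)
have rad A X : vfield U (A X) -> (forall W p, section U S W -> U p ->
      g (i p) (pushforward i p (A X p)) (pushforward i p (W p)) = 0) ->
    section U (Rad i g) (A X).
  move=> UA A0; split=> // p Up; have tA : tangent p (A X p) by exact: UA.1.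
  have tpA := pushforward_tangent si tA.
  split=> //; split=> // u /SRad [s [v [Ss [tv [_ Rv]] ->]]].
  have [W [[SW SWp] Wp]] := distribution_extension HS Ss.
  have tps := pushforward_tangent si (distribution_tangent HS Ss).
  have tpv := pushforward_tangent si tv.
  rewrite -[s]scale1r pushforwardP (metricC Hg) //; last exact: tangentP.
  rewrite (metric_lin Hg) // Rv // addr0 mul1r (metricC Hg) // -Wp A0 //.
  by split=> [|q _]; [exact: field_along_sub SW|exact: SWp].
(* The Gauss formula supplies the smoothness of [D X W], the screen decomposition its values. *)
have parallelS D DS F Db' G : gauss_formula i U N Db' D G ->
    screen_decomposition S U xi D DS F ->
    (forall X W p, vfield U X -> section U S W -> U p -> F X W p = 0) ->
    parallel U S D.
  move=> HG HF F0 X W UX SW; split=> [|p Up]; first by case: (HG X W UX SW.1).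
  have [[_ SDS] /(_ p Up) ->] := HF X W UX SW.
  by rewrite F0 // scale0r addr0; exact: SDS.
(* The implications are proved in a cycle: (1) to (2), (2) to (3), (3) to (4), (4) to (1). *)
tfae.
- move=> [pn pns] X W UX SW p Up.
  by split; [exact: parallel0 pn HC _ _ _|exact: parallel0 pns HCs _ _ _].
- move=> C0 X UX; have [UA _] := Hweingartens X UX.
  have [UAs _] := Hweingarten X UX.
  split; apply: rad => // W p SW Up.
    by rewrite -CE //; case: (C0 X W UX SW p Up).
  by rewrite -CsE //; case: (C0 X W UX SW p Up).
(* Radical shape operators make both forms vanish, so both connections preserve the screen; half
   sums and half differences then stay in it. *)
- move=> HA.
  have Rad0 v W p : section U S W -> Rad i g p v -> U p ->
      g (i p) (pushforward i p v) (pushforward i p (W p)) = 0.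
    by move=> [[tW _] _] [_ [_ Rv]] Up; apply: Rv; exact: tW.
  have pn : parallel U S nab.
    apply: parallelS Hgauss HC _ => X W p UX SW Up.
    by rewrite CE // Rad0 //; case: (HA X UX) => -[_ + _]; exact.
  have pns : parallel U S nabs.
    apply: parallelS Hgausss HCs _ => X W p UX SW Up.
    by rewrite CsE // Rad0 //; case: (HA X UX) => _ [_]; exact.
  split=> X W UX SW.
    have := section_lin HS HU 2^-1 2^-1 (pn X W UX SW) (pns X W UX SW).
    by under eq_fun do rewrite -scalerDr.
  have := section_lin HS HU 2^-1 (- 2^-1) (pn X W UX SW) (pns X W UX SW).
  by under eq_fun do rewrite scaleNr -scalerBr.
(* [nab] is the mean connection plus the difference tensor, and [nabs] is the mean connection minus
   it. *)
- move=> [pm dS].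
  have two : (2^-1 + 2^-1 : R) = 1 by rewrite [RHS]splitr div1r.
  split=> X W UX SW.
    have := section_lin HS HU 1 1 (pm X W UX SW) (dS X W UX SW).
    congr section; apply/funext => p; rewrite !scale1r -scalerDr.
    by rewrite addrACA subrr addr0 scalerDr -scalerDl two scale1r.
  have := section_lin HS HU 1 (-1) (pm X W UX SW) (dS X W UX SW).
  congr section; apply/funext => p; rewrite scale1r scaleN1r -scalerBr.
  by rewrite opprB addrC subrKA scalerDr -scalerDl two scale1r.
Qed.
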